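(* Let $\mu\geq 2$ and $0<r\le\sqrt{\mu}$ be real numbers. Then the function $$\mathbb{Q}_{\mu}(r;z)=z+\sum_{n=2}^{\infty}\frac{n!\,(r^2+1)^{\mu+1}}{((n!)^2+r^2)^{\mu+1}}z^n,\qquad z\in\mathbb{U},$$ is starlike in $\mathbb{U}$.
   Context: $\mathbb{U}=\{z\in\mathbb{C}:|z|<1\}$ is the open unit disk, and $\mathscr{A}$ is the class of analytic functions $f$ on $\mathbb{U}$ with $f(0)=0$ and $f'(0)=1$. A function $f\in\mathscr{A}$ is called starlike if it maps $\mathbb{U}$ onto a domain that is starlike with respect to the origin; analytically, starlike functions are characterized by $\Re\left(zf'(z)/f(z)\right)>0$ for all $z\in\mathbb{U}$ (the quotient being understood as its limit $1$ at $z=0$). *)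

(* Defs.v *)
From Stdlib Require Import Reals Factorial Lra Lia.
From Coquelicot Require Import Coquelicot.
Open Scope R_scope.

Definition unit_disk (z : C) : Prop := Cmod z < 1.

(** Derivatives are complex derivatives: [ex_derive] below is taken over the
    field [C_AbsRing], and [C_derive f z] is the value of [f'(z)] whenever it
    exists ([C_derive_correct]).  "Analytic" is read as complex differentiable
    at every point of the (open) disk. *)
Definition class_A (f : C -> C) : Prop :=
  (forall z : C, unit_disk z -> ex_derive (K := C_AbsRing) (V := C_NormedModule) f z) /\
  f (RtoC 0) = RtoC 0 /\
  C_derive f (RtoC 0) = RtoC 1.

Definition univalent (f : C -> C) : Prop :=
  forall z1 z2 : C, unit_disk z1 -> unit_disk z2 -> f z1 = f z2 -> z1 = z2.

Definition disk_image (f : C -> C) (w : C) : Prop :=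
  exists z : C, unit_disk z /\ f z = w.

Definition connected_set (D : C -> Prop) : Prop :=
  forall A B : C -> Prop,
    open A -> open B ->
    (forall w, D w -> A w \/ B w) ->
    (exists w, D w /\ A w) -> (exists w, D w /\ B w) ->
    exists w, D w /\ A w /\ B w.

Definition domain (D : C -> Prop) : Prop :=
  (exists w, D w) /\ open D /\ connected_set D.

Definition starlike_wrt_0 (D : C -> Prop) : Prop :=
  forall (w : C) (t : R), D w -> 0 <= t <= 1 -> D (Cmult (RtoC t) w).

(** Univalence is part of the classical notion: only for univalent [f] is
    starlikeness of the image domain equivalent to positivity of
    [Re (z f'(z) / f(z))]. *)
Definition starlike (f : C -> C) : Prop :=
  class_A f /\ univalent f /\
  domain (disk_image f) /\ starlike_wrt_0 (disk_image f).

(** [z f'(z) / f(z)], with its limit value [1] at the origin.  If [f z = 0]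
    at some [z <> 0], the division of Coquelicot returns [0], so that strict
    positivity of the real part also forces [f z <> 0] there. *)
Definition starlike_quotient (f : C -> C) (z : C) : C :=
  if Ceq_dec z (RtoC 0) then RtoC 1
  else Cdiv (Cmult z (C_derive f z)) (f z).

Definition Q_coef (mu r : R) (n : nat) : R :=
  INR (fact n) * Rpower (r ^ 2 + 1) (mu + 1)
  / Rpower (INR (fact n) ^ 2 + r ^ 2) (mu + 1).

Definition Q_term (mu r : R) (z : C) (n : nat) : C :=
  Cmult (RtoC (Q_coef mu r n)) (Cpow z n).

(** Sum of a convergent complex series. *)
Definition C_series (u : nat -> C) : C :=
  iota (T := CompleteNormedModule.CompleteSpace C_AbsRing C_CompleteNormedModule)
       (is_series (V := C_NormedModule) u).

(** The tail [n = 2, 3, ...] of the series is indexed by [k = n - 2]; it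
    converges on the unit disk, see [Qmu_converges]. *)
Definition Qmu (mu r : R) (z : C) : C :=
  Cplus z (C_series (fun k : nat => Q_term mu r z (k + 2))).

Lemma Q_coef_bound (mu r : R) (n : nat) :
  0 <= mu -> 0 <= Q_coef mu r n <= Rpower (r ^ 2 + 1) (mu + 1).
Proof.
intros Hmu. unfold Q_coef.
assert (Hf : 1 <= INR (fact n)).
{ apply (le_INR 1). generalize (lt_O_fact n). lia. }
set (x := INR (fact n)) in *.
set (P := Rpower (r ^ 2 + 1) (mu + 1)).
assert (HP : 0 < P) by apply exp_pos.
set (b := x ^ 2 + r ^ 2).
assert (Hb : x <= b) by (unfold b; nra).
assert (HD : b <= Rpower b (mu + 1)).
{ rewrite <- (Rpower_1 b) at 1 by lra. apply Rle_Rpower; lra. }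
set (D := Rpower b (mu + 1)) in *.
assert (HD0 : 0 < D) by apply exp_pos.
split.
- apply Rlt_le, Rdiv_lt_0_compat; nra.
- apply (Rmult_le_reg_r D); [exact HD0|].
  unfold Rdiv. rewrite Rmult_assoc, Rinv_l by lra. nra.
Qed.

Lemma Qmu_converges (mu r : R) (z : C) :
  0 <= mu -> unit_disk z ->
  is_series (V := C_NormedModule) (fun k : nat => Q_term mu r z (k + 2))
            (Cminus (Qmu mu r z) z).
Proof.
intros Hmu Hz.
assert (Hex : ex_series (V := C_NormedModule) (fun k : nat => Q_term mu r z (k + 2))).
{ apply (ex_series_le (K := C_AbsRing) (V := C_CompleteNormedModule))
    with (b := fun k => scal (Rpower (r ^ 2 + 1) (mu + 1)) (Cmod z ^ k)).
  - intros k. change (norm (Q_term mu r z (k + 2)))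
      with (Cmod (Q_term mu r z (k + 2))).
    unfold Q_term. rewrite Cmod_mult, Cmod_R, Cmod_pow.
    destruct (Q_coef_bound mu r (k + 2) Hmu) as [H0 H1].
    rewrite Rabs_pos_eq by exact H0.
    unfold scal; simpl; unfold mult; simpl.
    generalize (Cmod_ge_0 z); intros Hm. unfold unit_disk in Hz.
    apply Rmult_le_compat; [exact H0 | now apply pow_le | exact H1 |].
    rewrite pow_add. generalize (pow_le (Cmod z) k Hm). intros Hk.
    rewrite <- (Rmult_1_r (Cmod z ^ k)) at 2.
    apply Rmult_le_compat_l; [exact Hk | simpl; nra].
  - apply (ex_series_scal (K := R_AbsRing) (V := R_NormedModule)), ex_series_geom.
    rewrite Rabs_pos_eq; [exact Hz | apply Cmod_ge_0]. }
destruct Hex as [l0 Hl]; pose (l := l0 : C); change l0 with l in Hl.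
assert (E : C_series (fun k : nat => Q_term mu r z (k + 2)) = l)
  by exact (iota_filterlim_locally (V := C_CompleteNormedModule) _ l Hl).
replace (Cminus (Qmu mu r z) z) with l; [exact Hl|].
unfold Qmu. rewrite E. clearbody l.
change (@eq C l (Cminus (Cplus z l) z)). ring.
Qed.

(* Main.v *)
Require Import Defs.
From Stdlib Require Import Reals Factorial Lra Lia.
From Coquelicot Require Import Coquelicot.
Open Scope R_scope.

(** Write [f z = z + g z] with [g z = sum_(n >= 2) a_n z^n], and put
    [c = sum n |a_n|] and [L = sum (n - 1) |a_n|].  On the disk [g] is
    [c]-Lipschitz and [|z g'(z) - g(z)| <= L |z|^2].  When [c + L <= 1] (so
    [c < 1]), [f] is univalent, [Re (z f'/f) > 0] since
    [|z f' - f| <= L |z|^2 < |f|], and [w + g w = zeta] can be solved by the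
    Banach fixed point theorem in any closed disk about [z0] of radius [rho]
    as soon as [|zeta - f z0| <= (1 - c) rho].  This gives openness of the
    image.  It also gives its starlikeness, by solving [f w = t f(z)] in the
    disk of centre [t z] and radius [(1 - t) |z|], which lies in
    [|w| <= |z|]: indeed [|t g(z) - g(t z)| <= L (1 - t) |z|].

    For [Q_mu], Bernoulli's inequality bounds [a_n] by its value at the
    extremal parameters [mu = 2], [r^2 = 2], and this yields
    [n^2 a_n <= 4^(2 - n)], hence [c + L <= 3/4 sum_(k >= 0) 4^(-k) = 1]. *)

(** * Norm estimates for complex series and limits *)

Lemma Cmod_minus_triangle (x y z : C) : Cmod (x - z) <= Cmod (x - y) + Cmod (y - z).
Proof.
replace (x - z)%C with ((x - y) + (y - z))%C by ring. apply Cmod_triangle.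
Qed.

Lemma Cmod_minus_sym (x y : C) : Cmod (x - y) = Cmod (y - x).
Proof. replace (x - y)%C with (- (y - x))%C by ring. apply Cmod_opp. Qed.

(** The bound passes from partial sums to the limit. The factor [B], independent of [k], stays
    outside the series, so that later estimates read as a constant such as [c] or [L] times a
    distance. *)
Lemma Cmod_series_le (u : nat -> C) (l : C) (m : nat -> R) (B : R) :
  is_series (V := C_NormedModule) u l ->
  (forall k, Cmod (u k) <= m k * B) -> ex_series m ->
  Cmod l <= Series m * B.
Proof.
intros Hu Hle Hm.
assert (H1 : is_lim_seq (fun n => Cmod (sum_n u n)) (Cmod l)).
{ exact (filterlim_comp _ _ _ (sum_n (G := C_AbelianMonoid) u) Cmod _ _ _ Hu
           (filterlim_norm (V := C_NormedModule) l)). }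
assert (H2 : is_lim_seq (sum_n (fun k => m k * B)) (Series m * B)).
{ apply (is_series_scal_r B m), Series_correct, Hm. }
apply (is_lim_seq_le (fun n => Cmod (sum_n u n)) (sum_n (fun k => m k * B)))
  with (2 := H1) (3 := H2).
intros n.
eapply Rle_trans; [apply (norm_sum_n_m (V := C_NormedModule) u 0 n)|].
apply sum_n_m_le. exact Hle.
Qed.

Lemma Series_ge_0 (m : nat -> R) : (forall k, 0 <= m k) -> ex_series m -> 0 <= Series m.
Proof.
intros H0 Hm. rewrite <- (Rmult_0_l (Series m)), <- Series_scal_l.
apply Series_le; [|exact Hm]. intros k. generalize (H0 k). lra.
Qed.

Lemma Cmod_le_filterlim (u : nat -> C) (l z : C) (B : R) :
  filterlim u eventually (locally (T := C_NormedModule) l) ->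
  (forall n, Cmod (u n - z) <= B) -> Cmod (l - z) <= B.
Proof.
intros Hu HB.
assert (H : is_lim_seq (fun n => Cmod (u n - z)) (Cmod (l - z))).
{ apply (filterlim_comp _ _ _ (fun n => (u n - z)%C) Cmod _ (locally (T := C_NormedModule) (l - z)%C));
    [|exact (filterlim_norm (V := C_NormedModule) (l - z)%C)].
  apply (filterlim_comp_2 (V := C_NormedModule) (W := C_NormedModule) (G := locally l)
    (H := locally (T := C_NormedModule) (Copp z))
    u (fun _ => Copp z) Cplus); [exact Hu | apply filterlim_const |].
  exact (filterlim_plus (V := C_NormedModule) l (Copp z)). }
exact (is_lim_seq_le _ _ (Cmod (l - z)) B HB H (is_lim_seq_const B)).
Qed.

(** * Fixed points and perturbations of the identity *)

(** The iterates of [T] from the centre stay in the disk and their increments decay like [c ^ n], so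
    they converge, and the limit is fixed. Everything is asked on the closed disk alone, because the
    tail [g] is controlled only inside the unit disk. *)
Lemma banach_closed_disk (T : C -> C) (c rho : R) (z0 : C) :
  0 <= c < 1 -> 0 <= rho ->
  (forall w, Cmod (w - z0) <= rho -> Cmod (T w - z0) <= rho) ->
  (forall w w', Cmod (w - z0) <= rho -> Cmod (w' - z0) <= rho ->
     Cmod (T w - T w') <= c * Cmod (w - w')) ->
  exists w, Cmod (w - z0) <= rho /\ T w = w.
Proof.
intros Hc Hrho Hmap Hlip.
pose (u := fix u n := match n with O => z0 | S n => T (u n) end).
assert (Hin : forall n, Cmod (u n - z0) <= rho).
{ induction n as [|n IH]; simpl; [|auto].
  replace (z0 - z0)%C with (RtoC 0) by ring. now rewrite Cmod_0. }
assert (Hstep : forall n, Cmod (u (S n) - u n) <= c ^ n * rho).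
{ induction n as [|n IH].
  - rewrite pow_O, Rmult_1_l. exact (Hin 1%nat).
  - eapply Rle_trans; [exact (Hlip _ _ (Hin (S n)) (Hin n))|].
    simpl pow. rewrite Rmult_assoc. apply Rmult_le_compat_l; [lra | exact IH]. }
assert (Hex : ex_series (V := C_NormedModule) (fun n => (u (S n) - u n)%C)).
{ apply (ex_series_le (K := C_AbsRing) (V := C_CompleteNormedModule))
    with (b := fun k => c ^ k * rho); [exact Hstep|].
  apply (ex_series_scal_r rho), ex_series_geom. rewrite Rabs_pos_eq; lra. }
destruct Hex as [l0 Hl].
set (l := (l0 + z0)%C : C).
assert (Hlim : filterlim (fun n => u (S n)) eventually (locally (T := C_NormedModule) l)).
(* The increments up to index [n] telescope to [u (S n) - z0], hence the shifted sequence. *)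
{ apply (filterlim_ext (fun n => Cplus (sum_n (G := C_AbelianMonoid) (fun n => (u (S n) - u n)%C) n) z0)).
  - induction x as [|n IH].
    + rewrite sum_O. simpl. ring.
    + rewrite sum_Sn. rewrite <- IH. unfold plus; simpl. ring.
  - apply (filterlim_comp_2 (V := C_NormedModule) (W := C_NormedModule) (G := locally (T := C_NormedModule) l0)
      (H := locally (T := C_NormedModule) z0)
      _ (fun _ => z0) Cplus); [exact Hl | apply filterlim_const |].
    exact (filterlim_plus (V := C_NormedModule) l0 z0). }
assert (Hlin : Cmod (l - z0) <= rho).
{ apply (Cmod_le_filterlim (fun n => u (S n)) l); [exact Hlim|].
  intros n. apply Hin. }
exists l. split; [exact Hlin|].
assert (Hk : forall k, Cmod (l - u (S k)) <= c ^ S k * (rho / (1 - c))).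
{ intros k.
  apply (Cmod_le_filterlim (fun n => u (S (k + n))) l).
  - apply (filterlim_comp _ _ _ (fun n => (k + n)%nat) (fun n => u (S n)) _ eventually); [|exact Hlim].
    intros P [N HN]. exists N. intros n Hn. apply HN. lia.
  - intros n.
    (* This is the finite geometric sum of the bounds [Hstep] for the indices from [k + 1] to
       [k + n]. *)
    assert (Hn : Cmod (u (S (k + n)) - u (S k)) <= (c ^ S k - c ^ S (k + n)) * (rho / (1 - c))).
    { induction n as [|n IH].
      - rewrite Nat.add_0_r. replace (u (S k) - u (S k))%C with (RtoC 0) by ring.
        rewrite Cmod_0. lra.
      - rewrite Nat.add_succ_r.
        eapply Rle_trans; [apply (Cmod_minus_triangle _ (u (S (k + n))))|].
        eapply Rle_trans; [apply Rplus_le_compat; [apply Hstep | exact IH]|].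
        right. simpl pow. field. lra. }
    eapply Rle_trans; [exact Hn|].
    apply Rmult_le_compat_r; [apply Rdiv_le_0_compat; lra|].
    generalize (pow_le c (S (k + n))). lra. }
assert (H0 : Cmod (T l - l) <= 0).
(* Compare [T l] and [l] with [T (u (S k))], which is also [u (S (S k))]. Each distance is at most
   [c ^ 2 * c ^ k * (rho / (1 - c))]; dropping [c ^ 2] leaves the factor 2. *)
{ assert (Hb : forall k, Cmod (T l - l) <= c ^ k * (2 * (rho / (1 - c)))).
  { intros k.
    eapply Rle_trans; [apply (Cmod_minus_triangle _ (T (u (S k))))|].
    rewrite (Cmod_minus_sym (T (u (S k)))).
    assert (H1 := Hlip _ _ Hlin (Hin (S k))).
    assert (H2 : Cmod (l - T (u (S k))) <= c ^ S (S k) * (rho / (1 - c))) by exact (Hk (S k)).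
    assert (H3 : c * Cmod (l - u (S k)) <= c * (c ^ S k * (rho / (1 - c)))).
    { apply Rmult_le_compat_l; [lra | apply Hk]. }
    assert (HB : 0 <= c ^ k * (rho / (1 - c))).
    { apply Rmult_le_pos; [apply pow_le; lra | apply Rdiv_le_0_compat; lra]. }
    cbn [pow] in H2, H3.
    assert (HC : c * (c * (c ^ k * (rho / (1 - c)))) <= c ^ k * (rho / (1 - c))).
    { assert (c * c <= 1) by nra. rewrite <- Rmult_assoc. nra. }
    replace (c * (c * c ^ k) * (rho / (1 - c))) with (c * (c * (c ^ k * (rho / (1 - c))))) in H2 by ring.
    replace (c * c ^ k * (rho / (1 - c))) with (c * (c ^ k * (rho / (1 - c)))) in H3 by ring.
    lra. }
  apply (is_lim_seq_le (fun _ => Cmod (T l - l)) (fun k => c ^ k * (2 * (rho / (1 - c))))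
    (Cmod (T l - l)) 0 Hb (is_lim_seq_const _)).
  replace (Finite 0) with (Rbar_mult (Finite 0) (2 * (rho / (1 - c)))) by (simpl; f_equal; ring).
  apply is_lim_seq_scal_r, is_lim_seq_geom. rewrite Rabs_pos_eq; lra. }
assert (E : (T l - l)%C = RtoC 0).
{ apply Cmod_eq_0. generalize (Cmod_ge_0 (T l - l)). lra. }
replace (T l) with ((T l - l) + l)%C by ring. rewrite E. ring.
Qed.

(** A solution is a fixed point of [w => zeta - g w]. This map preserves the disk because its
    distance to [z0] is at most [(1 - c) * rho + c * rho]. *)
Lemma perturbed_id_solvable (g : C -> C) (c rho : R) (z0 zeta : C) :
  0 <= c < 1 -> 0 <= rho ->
  (forall w w', Cmod (w - z0) <= rho -> Cmod (w' - z0) <= rho ->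
     Cmod (g w - g w') <= c * Cmod (w - w')) ->
  Cmod (zeta - (z0 + g z0)) <= (1 - c) * rho ->
  exists w, Cmod (w - z0) <= rho /\ (w + g w)%C = zeta.
Proof.
intros Hc Hrho Hlip Hz.
assert (H00 : Cmod (z0 - z0) <= rho).
{ replace (z0 - z0)%C with (RtoC 0) by ring. now rewrite Cmod_0. }
destruct (banach_closed_disk (fun w => (zeta - g w)%C) c rho z0 Hc Hrho) as [w [Hw E]].
- intros w Hw.
  replace (zeta - g w - z0)%C with ((zeta - (z0 + g z0)) + (g z0 - g w))%C by ring.
  eapply Rle_trans; [apply Cmod_triangle|].
  generalize (Hlip _ _ H00 Hw). rewrite (Cmod_minus_sym z0 w). nra.
- intros w w' Hw Hw'.
  replace (zeta - g w - (zeta - g w'))%C with (g w' - g w)%C by ring.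
  rewrite (Cmod_minus_sym w w'). now apply Hlip.
- exists w. split; [exact Hw|]. rewrite <- E at 1. ring.
Qed.

(** * Powers on the unit disk *)

Lemma Cpow_le_1 (z : C) (n : nat) : unit_disk z -> Cmod (z ^ n) <= 1.
Proof.
intros Hz. rewrite Cmod_pow. generalize (Cmod_ge_0 z); intros H0. unfold unit_disk in Hz.
induction n as [|n IH]; simpl; [lra|].
generalize (pow_le _ n H0). nra.
Qed.

Lemma Cmod_Cpow_minus_le (z w : C) (n : nat) :
  unit_disk z -> unit_disk w -> Cmod (w ^ n - z ^ n) <= INR n * Cmod (w - z).
Proof.
intros Hz Hw. induction n as [|n IH].
- simpl. replace (1 - 1)%C with (RtoC 0) by ring. rewrite Cmod_0. lra.
- replace (w ^ S n - z ^ S n)%C with (w * (w ^ n - z ^ n) + z ^ n * (w - z))%C by (simpl; ring).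
  eapply Rle_trans; [apply Cmod_triangle|]. rewrite !Cmod_mult, S_INR.
  generalize (Cpow_le_1 z n Hz) (Cmod_ge_0 (w - z)) (Cmod_ge_0 (w ^ n - z ^ n)) (Cmod_ge_0 w).
  unfold unit_disk in *. nra.
Qed.

(** In the induction the new remainder is [w] times the old one plus [N * z ^ n * (w - z) ^ 2],
    where [N = n + 1], and [N ^ 2 + N <= (N + 1) ^ 2]. The crude constant suffices, since the
    coefficients are summable against it. *)
Lemma Cmod_Cpow_taylor_le (z w : C) (n : nat) :
  unit_disk z -> unit_disk w ->
  Cmod (w ^ S n - z ^ S n - INR (S n) * z ^ n * (w - z)) <= INR (S n) ^ 2 * Cmod (w - z) ^ 2.
Proof.
intros Hz Hw. induction n as [|n IH].
- replace (w ^ 1 - z ^ 1 - INR 1 * z ^ 0 * (w - z))%C with (RtoC 0) by (simpl; ring).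
  rewrite Cmod_0. simpl. generalize (Cmod_ge_0 (w - z)). nra.
- replace (w ^ S (S n) - z ^ S (S n) - INR (S (S n)) * z ^ S n * (w - z))%C
    with (w * (w ^ S n - z ^ S n - INR (S n) * z ^ n * (w - z))
          + INR (S n) * z ^ n * (w - z) * (w - z))%C.
  2: { rewrite (S_INR (S n)), RtoC_plus. simpl Cpow. ring. }
  eapply Rle_trans; [apply Cmod_triangle|]. rewrite !Cmod_mult, Cmod_R, Rabs_pos_eq by apply pos_INR.
  rewrite (S_INR (S n)).
  set (N := INR (S n)) in *. assert (HN : 0 <= N) by apply pos_INR.
  set (d := Cmod (w - z)) in *. assert (Hd : 0 <= d) by apply Cmod_ge_0.
  set (X := Cmod (w ^ S n - z ^ S n - N * z ^ n * (w - z))) in *.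
  assert (HX : 0 <= X) by apply Cmod_ge_0.
  generalize (Cpow_le_1 z n Hz); intros Hp.
  assert (Hw0 := Cmod_ge_0 w). unfold unit_disk in *.
  assert (N * Cmod (z ^ n) * d * d <= N * d ^ 2).
  { replace (N * Cmod (z ^ n) * d * d) with (Cmod (z ^ n) * (N * d ^ 2)) by ring.
    assert (0 <= N * d ^ 2) by (apply Rmult_le_pos; [lra | apply pow2_ge_0]). nra. }
  assert (Cmod w * X <= X) by nra.
  assert (0 <= d ^ 2) by apply pow2_ge_0. nra.
Qed.

Lemma one_minus_pow_le (t : R) (n : nat) : 0 <= t <= 1 -> 0 <= 1 - t ^ n <= INR n * (1 - t).
Proof.
intros Ht. induction n as [|n IH]; [simpl; lra|].
rewrite S_INR. simpl pow. generalize (pow_le t n (proj1 Ht)). nra.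
Qed.

(** With [n = k + 2] the difference is [t * (1 - t ^ (n - 1)) * z ^ n], so the weight is [n - 1]
    rather than [n]. This gain is what makes [L] appear in the estimate along rays. *)
Lemma Cmod_ray_Cpow_le (z : C) (t : R) (k : nat) :
  unit_disk z -> 0 <= t <= 1 ->
  Cmod (t * z ^ (k + 2) - (t * z) ^ (k + 2)) <= INR (k + 1) * ((1 - t) * Cmod z).
Proof.
intros Hz Ht.
replace (t * z ^ (k + 2) - (t * z) ^ (k + 2))%C
  with (RtoC (t * (1 - t ^ (k + 1))) * (z * z ^ (k + 1)))%C.
2: { rewrite Cpow_mult_l. replace (k + 2)%nat with (S (k + 1)) by lia. simpl Cpow.
     rewrite RtoC_mult, RtoC_minus, RtoC_pow. ring. }
rewrite !Cmod_mult, Cmod_R.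
destruct (one_minus_pow_le t (k + 1) Ht) as [H0 H1].
rewrite Rabs_pos_eq by (apply Rmult_le_pos; lra).
generalize (Cpow_le_1 z (k + 1) Hz) (Cmod_ge_0 (z ^ (k + 1))) (Cmod_ge_0 z); intros H2 H3 H4.
rewrite <- (Rmult_assoc (INR (k + 1))).
apply Rmult_le_compat; [apply Rmult_le_pos; lra | now apply Rmult_le_pos | nra | nra].
Qed.

Lemma INR_shift1 (k : nat) : INR (k + 1) = INR k + 1.
Proof. now rewrite plus_INR. Qed.

Lemma INR_shift2 (k : nat) : INR (k + 2) = INR k + 2.
Proof. now rewrite plus_INR. Qed.

Lemma unit_disk_ray (z : C) (t : R) : unit_disk z -> 0 <= t <= 1 -> unit_disk (t * z).
Proof.
unfold unit_disk. intros Hz Ht. rewrite Cmod_mult, Cmod_R, Rabs_pos_eq by lra.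
generalize (Cmod_ge_0 z). nra.
Qed.

(** * Power series starting at degree 2 *)

Section PowerSeries.

Variables (a : nat -> C) (g : C -> C).
Hypothesis g_series : forall z, unit_disk z ->
  is_series (V := C_NormedModule) (fun k => a k * z ^ (k + 2))%C (g z).
(** The weight [n ^ 2], with [n = k + 2], matches the Taylor remainder of [Cmod_Cpow_taylor_le] and
    dominates the weights [n] and [n - 1] of the two constants. *)
Hypothesis a_summable : ex_series (fun k => INR (k + 2) ^ 2 * Cmod (a k)).

Lemma ex_series_coef_le (m : nat -> R) :
  (forall k, 0 <= m k <= INR (k + 2) ^ 2) -> ex_series (fun k => m k * Cmod (a k)).
Proof.
intros Hm. apply (ex_series_le (V := R_CompleteNormedModule)) with (2 := a_summable).
intros k. change (Rabs (m k * Cmod (a k)) <= INR (k + 2) ^ 2 * Cmod (a k)).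
destruct (Hm k). assert (H2 := Cmod_ge_0 (a k)).
rewrite Rabs_pos_eq by now apply Rmult_le_pos.
now apply Rmult_le_compat_r.
Qed.

Lemma ex_series_coef1 : ex_series (fun k => INR (k + 1) * Cmod (a k)).
Proof.
apply ex_series_coef_le. intros k. rewrite INR_shift1, INR_shift2.
generalize (pos_INR k). nra.
Qed.

Lemma ex_series_coef2 : ex_series (fun k => INR (k + 2) * Cmod (a k)).
Proof.
apply ex_series_coef_le. intros k. rewrite INR_shift2.
generalize (pos_INR k). nra.
Qed.

Lemma Cmod_coef_le (k : nat) (x : C) (m B : R) :
  Cmod x <= m * B -> Cmod (a k * x) <= m * Cmod (a k) * B.
Proof.
intros H. rewrite Cmod_mult. generalize (Cmod_ge_0 (a k)). nra.
Qed.

Lemma tail_lipschitz (z w : C) : unit_disk z -> unit_disk w ->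
  Cmod (g w - g z) <= Series (fun k => INR (k + 2) * Cmod (a k)) * Cmod (w - z).
Proof.
intros Hz Hw.
apply (Cmod_series_le _ _ _ _ (is_series_minus _ _ _ _ (g_series w Hw) (g_series z Hz)));
  [|exact ex_series_coef2].
intros k. change (Cmod (a k * w ^ (k + 2) - a k * z ^ (k + 2))
  <= INR (k + 2) * Cmod (a k) * Cmod (w - z)).
replace (a k * w ^ (k + 2) - a k * z ^ (k + 2))%C
  with (a k * (w ^ (k + 2) - z ^ (k + 2)))%C by ring.
now apply Cmod_coef_le, Cmod_Cpow_minus_le.
Qed.

Lemma tail_ray (z : C) (t : R) : unit_disk z -> 0 <= t <= 1 ->
  Cmod (t * g z - g (t * z)) <= Series (fun k => INR (k + 1) * Cmod (a k)) * ((1 - t) * Cmod z).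
Proof.
intros Hz Ht.
apply (Cmod_series_le _ _ _ _ (is_series_minus _ _ _ _
   (is_series_scal (V := C_NormedModule) (RtoC t) _ _ (g_series z Hz))
   (g_series (t * z)%C (unit_disk_ray z t Hz Ht)))); [|exact ex_series_coef1].
intros k. change (Cmod (t * (a k * z ^ (k + 2)) - a k * (t * z) ^ (k + 2))
  <= INR (k + 1) * Cmod (a k) * ((1 - t) * Cmod z)).
replace (t * (a k * z ^ (k + 2)) - a k * (t * z) ^ (k + 2))%C
  with (a k * (t * z ^ (k + 2) - (t * z) ^ (k + 2)))%C by ring.
now apply Cmod_coef_le, Cmod_ray_Cpow_le.
Qed.

(** Here [d] is the termwise derivative: summing the Taylor remainders of the powers gives a
    remainder quadratic in [w - z]. In [z * d - g z] the coefficient of [z ^ n] becomes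
    [(n - 1) * a_n], and all degrees are at least 2, whence the factor [Cmod z ^ 2]. *)
Lemma tail_derive (z : C) : unit_disk z ->
  exists d : C, is_derive (K := C_AbsRing) (V := C_NormedModule) g z d /\
    Cmod d <= Series (fun k => INR (k + 2) * Cmod (a k)) * Cmod z /\
    Cmod (z * d - g z) <= Series (fun k => INR (k + 1) * Cmod (a k)) * Cmod z ^ 2.
Proof.
intros Hz.
assert (Hex : ex_series (V := C_NormedModule) (fun k => (a k * (INR (k + 2) * z ^ (k + 1)))%C)).
{ apply (ex_series_le (K := C_AbsRing) (V := C_CompleteNormedModule))
    with (2 := ex_series_coef2).
  intros k. change (Cmod (a k * (INR (k + 2) * z ^ (k + 1))) <= INR (k + 2) * Cmod (a k)).
  rewrite <- (Rmult_1_r (INR (k + 2) * Cmod (a k))). apply Cmod_coef_le.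
  rewrite Cmod_mult, Cmod_R, Rabs_pos_eq by apply pos_INR.
  apply Rmult_le_compat_l; [apply pos_INR | now apply Cpow_le_1]. }
destruct Hex as [d Hd]. exists d. split; [|split].
- split; [apply (is_linear_scal_l (V := C_NormedModule))|].
  intros x Hx.
  (* The definition of the differential quantifies over every limit [x] of the filter [locally z];
     such a limit is [z] itself. *)
  assert (E := is_filter_lim_locally_unique (V := AbsRing_NormedModule C_AbsRing) _ _ Hx).
  change (z = x) in E. subst x.
  set (K := Series (fun k => INR (k + 2) ^ 2 * Cmod (a k))).
  assert (HK : forall w, unit_disk w -> Cmod (g w - g z - (w - z) * d) <= K * Cmod (w - z) ^ 2).
  { intros w Hw.
    apply (Cmod_series_le _ _ _ _ (is_series_minus _ _ _ _
      (is_series_minus _ _ _ _ (g_series w Hw) (g_series z Hz))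
      (is_series_scal (V := C_NormedModule) (w - z)%C _ _ Hd))); [|exact a_summable].
    intros k. change (Cmod (a k * w ^ (k + 2) - a k * z ^ (k + 2) - (w - z) * (a k * (INR (k + 2) * z ^ (k + 1))))
       <= INR (k + 2) ^ 2 * Cmod (a k) * Cmod (w - z) ^ 2).
    replace (a k * w ^ (k + 2) - a k * z ^ (k + 2) - (w - z) * (a k * (INR (k + 2) * z ^ (k + 1))))%C
      with (a k * (w ^ (k + 2) - z ^ (k + 2) - INR (k + 2) * z ^ (k + 1) * (w - z)))%C by ring.
    apply Cmod_coef_le.
    replace (k + 2)%nat with (S (k + 1)) by lia. now apply Cmod_Cpow_taylor_le. }
  intros eps.
  (* Adding 1 keeps the divisor positive even if [K] vanishes; the other bound, [1 - Cmod z], keeps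
     [w] in the unit disk. *)
  assert (HKp : 0 < Rabs K + 1) by (generalize (Rabs_pos K); lra).
  assert (Hdel : 0 < Rmin (1 - Cmod z) (eps / (Rabs K + 1))).
  { apply Rmin_pos; [unfold unit_disk in Hz; lra | apply Rdiv_lt_0_compat; [apply cond_pos | exact HKp]]. }
  apply (locally_le_locally_norm (V := AbsRing_NormedModule C_AbsRing)).
  exists (mkposreal _ Hdel). intros w Hw.
  change (Cmod (w - z) < Rmin (1 - Cmod z) (eps / (Rabs K + 1))) in Hw.
  change (Cmod (g w - g z - (w - z) * d) <= eps * Cmod (w - z)).
  assert (Hw1 : Cmod (w - z) < 1 - Cmod z) by (eapply Rlt_le_trans; [exact Hw | apply Rmin_l]).
  assert (Hw2 : Cmod (w - z) < eps / (Rabs K + 1)) by (eapply Rlt_le_trans; [exact Hw | apply Rmin_r]).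
  assert (Hwu : unit_disk w).
  { unfold unit_disk. replace w with ((w - z) + z)%C by ring.
    eapply Rle_lt_trans; [apply Cmod_triangle | lra]. }
  eapply Rle_trans; [apply (HK w Hwu)|].
  apply Rlt_div_r in Hw2; [|exact HKp].
  generalize (Cmod_ge_0 (w - z)) (Rle_abs K). intros H0 H1.
  simpl pow. rewrite Rmult_1_r, <- Rmult_assoc.
  apply Rmult_le_compat_r; nra.
- apply (Cmod_series_le _ _ _ _ Hd); [|now apply ex_series_coef2].
  intros k. apply Cmod_coef_le.
  rewrite Cmod_mult, Cmod_R, Rabs_pos_eq by apply pos_INR.
  apply Rmult_le_compat_l; [apply pos_INR|].
  replace (k + 1)%nat with (S k) by lia. simpl Cpow. rewrite Cmod_mult.
  generalize (Cpow_le_1 z k Hz) (Cmod_ge_0 z). nra.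
- apply (Cmod_series_le _ _ _ _ (is_series_minus _ _ _ _
    (is_series_scal (V := C_NormedModule) z _ _ Hd) (g_series z Hz))); [|exact ex_series_coef1].
  intros k. change (Cmod (z * (a k * (INR (k + 2) * z ^ (k + 1))) - a k * z ^ (k + 2))
    <= INR (k + 1) * Cmod (a k) * Cmod z ^ 2).
  replace (z * (a k * (INR (k + 2) * z ^ (k + 1))) - a k * z ^ (k + 2))%C
    with (a k * (INR (k + 1) * (z ^ 2 * z ^ k)))%C.
  2: { replace (k + 2)%nat with (S (k + 1)) by lia. rewrite (S_INR (k + 1)), RtoC_plus.
       replace (k + 1)%nat with (S k) by lia. simpl Cpow. ring. }
  apply Cmod_coef_le.
  rewrite !Cmod_mult, Cmod_R, Rabs_pos_eq by apply pos_INR.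
  apply Rmult_le_compat_l; [apply pos_INR|].
  rewrite (Cmod_pow z 2). generalize (Cpow_le_1 z k Hz) (pow2_ge_0 (Cmod z)). nra.
Qed.

End PowerSeries.

(** * From coefficient bounds to starlikeness *)

(** If 0 lies in [A] and [w] in [B], follow the segment from 0 to [w], which stays in [D], up to the
    supremum [s] of the parameters whose points lie in [A]. A common point is found at [w] or just
    before [s]. *)
Lemma starlike_connected (D : C -> Prop) :
  D (RtoC 0) -> starlike_wrt_0 D -> connected_set D.
Proof.
intros H0 Hstar.
assert (Key : forall A B : C -> Prop, open A -> open B ->
    (forall w, D w -> A w \/ B w) -> A (RtoC 0) -> (exists w, D w /\ B w) ->
    exists w, D w /\ A w /\ B w).
{ intros A B HA HB Hcov HA0 [w [HDw HBw]].
  (* Continuity is obtained from real scalar multiplication in [C_R_NormedModule] and transferred to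
     [C_NormedModule]. *)
  assert (Hcont : forall s : R, continuous (fun t : R => (t * w)%C : C_NormedModule) s).
  { intros s P HP.
    apply (continuous_ext (fun t : R => scal t w : C_R_NormedModule)) with (x := s) (P := P).
    - intros t. change ((t * fst w, t * snd w) = (t * w)%C).
      unfold Cmult, RtoC; simpl. f_equal; ring.
    - apply (continuous_scal_l (V := C_R_NormedModule)). apply continuous_id.
    - exact HP. }
  assert (Hnear : forall (P : C -> Prop) (s : R), open P -> P (s * w)%C ->
    exists d : posreal, forall t, Rabs (t - s) < d -> P (t * w)%C).
  { intros P s HP Hs. destruct (Hcont s P (HP _ Hs)) as [d Hd].
    exists d. intros t Ht. apply Hd. exact Ht. }
  set (E := fun t : R => 0 <= t <= 1 /\ A (t * w)%C).
  assert (E0 : E 0).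
  { split; [lra|]. now replace (0 * w)%C with (RtoC 0) by ring. }
  destruct (completeness E) as [s [Hub Hlub]].
  { exists 1. intros t [Ht _]. lra. }
  { now exists 0. }
  assert (Hs0 : 0 <= s) by now apply Hub.
  assert (Hs1 : s <= 1) by (apply Hlub; intros t [Ht _]; lra).
  destruct (Hcov (s * w)%C (Hstar w s HDw (conj Hs0 Hs1))) as [HAs | HBs].
  (* If [s < 1], openness of [A] yields a member of [E] beyond its supremum; hence [s = 1] and [w]
     itself lies in [A]. *)
  - destruct (Rle_lt_or_eq_dec _ _ Hs1) as [Hlt | Heq].
    + destruct (Hnear A s HA HAs) as [d Hd].
      assert (Hd0 := cond_pos d).
      assert (Ht : E (s + Rmin (1 - s) (d / 2))).
      { assert (Hm : 0 < Rmin (1 - s) (d / 2)) by (apply Rmin_pos; lra).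
        assert (Hl := Rmin_l (1 - s) (d / 2)). assert (Hr := Rmin_r (1 - s) (d / 2)).
        split; [lra|]. apply Hd.
        replace (s + Rmin (1 - s) (d / 2) - s) with (Rmin (1 - s) (d / 2)) by ring.
        rewrite Rabs_pos_eq; lra. }
      assert (Hm : 0 < Rmin (1 - s) (d / 2)) by (apply Rmin_pos; lra).
      apply Hub in Ht. lra.
    + exists w. repeat split; [exact HDw | | exact HBw].
      replace w with (s * w)%C; [exact HAs|]. rewrite Heq. ring.
  (* A neighbourhood of [s] is mapped into [B], and [E] has a member in it because [s] is the least
     upper bound. *)
  - destruct (Hnear B s HB HBs) as [d Hd].
    destruct (Classical_Prop.classic (exists t, E t /\ s - d < t)) as [[t [[Ht HAt] Htd]] | Hno].
    + exists (t * w)%C. split; [now apply Hstar | split; [exact HAt|]].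
      apply Hd. assert (t <= s) by now apply Hub.
      rewrite Rabs_left1; lra.
    + assert (s <= s - d).
      { apply Hlub. intros t Ht. apply Rnot_lt_le. intros Hlt. apply Hno. now exists t. }
      generalize (cond_pos d). lra. }
intros A B HA HB Hcov HexA HexB.
destruct (Hcov _ H0) as [H | H].
- now apply Key.
- destruct (Key B A HB HA) as [w Hw]; try assumption.
  + intros w Hw. apply or_comm. now apply Hcov.
  + exists w. tauto.
Qed.

(** The quotient lies in the open disk of centre 1 and radius 1. *)
Lemma Re_quotient_pos (w v : C) : Cmod (v - w) < Cmod w -> 0 < Re (v / w).
Proof.
intros H.
assert (Hw : w <> RtoC 0).
{ apply Cmod_gt_0. generalize (Cmod_ge_0 (v - w)). lra. }
assert (Hw0 := proj1 (Cmod_gt_0 w) Hw).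
replace (v / w)%C with (1 + (v - w) / w)%C by (field; exact Hw).
assert (Hq : Cmod ((v - w) / w) < 1).
{ rewrite Cmod_div by exact Hw. apply Rlt_div_l; lra. }
generalize (re_le_Cmod ((v - w) / w)). intros Hre.
change (0 < 1 + Re ((v - w) / w)).
generalize (Rcomplements.Rabs_maj2 (Re ((v - w) / w))). lra.
Qed.

(** The weight is [2 n - 1 = n + (n - 1)] with [n = k + 2]. *)
Lemma starlike_of_coef_bound (a : nat -> C) (f : C -> C) :
  (forall z, unit_disk z ->
    is_series (V := C_NormedModule) (fun k => a k * z ^ (k + 2))%C (f z - z)%C) ->
  ex_series (fun k => INR (k + 2) ^ 2 * Cmod (a k)) ->
  Series (fun k => (2 * INR (k + 2) - 1) * Cmod (a k)) <= 1 ->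
  starlike f /\ (forall z, unit_disk z -> 0 < Re (starlike_quotient f z)).
Proof.
intros Hf Hsum Hle.
set (g := fun z => (f z - z)%C).
assert (fE : forall z, f z = (z + g z)%C) by (intros z; unfold g; ring).
set (c := Series (fun k => INR (k + 2) * Cmod (a k))).
set (L := Series (fun k => INR (k + 1) * Cmod (a k))).
assert (HcL : c + L <= 1).
{ unfold c, L. rewrite <- Series_plus by (apply ex_series_coef2 || apply ex_series_coef1; exact Hsum).
  erewrite Series_ext; [exact Hle|]. intros k. simpl. rewrite INR_shift1, INR_shift2. ring. }
assert (Hc0 : 0 <= c).
{ apply Series_ge_0; [|now apply ex_series_coef2].
  intros k. apply Rmult_le_pos; [apply pos_INR | apply Cmod_ge_0]. }
(* For [n >= 2] one has [n <= 2 * (n - 1)], so [c <= 2 * L <= 2 * (1 - c)]. This makes [g] a strict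
   contraction. *)
assert (Hc1 : c <= 2 / 3).
{ assert (c <= 2 * L).
  { unfold c, L. rewrite <- Series_scal_l. apply Series_le.
    - intros k. rewrite INR_shift1, INR_shift2.
      generalize (pos_INR k) (Cmod_ge_0 (a k)). intros H1 H2.
      split; [apply Rmult_le_pos; lra|]. rewrite <- Rmult_assoc.
      apply Rmult_le_compat_r; lra.
    - apply (ex_series_scal_l 2 (fun k => INR (k + 1) * Cmod (a k))). now apply ex_series_coef1. }
  lra. }
assert (HL0 : 0 <= L).
{ apply Series_ge_0; [|now apply ex_series_coef1].
  intros k. apply Rmult_le_pos; [apply pos_INR | apply Cmod_ge_0]. }
assert (Hlip : forall z w, unit_disk z -> unit_disk w -> Cmod (g w - g z) <= c * Cmod (w - z))
  by (intros z w; now apply tail_lipschitz).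
assert (H0u : unit_disk (RtoC 0)) by (unfold unit_disk; rewrite Cmod_0; lra).
assert (g0 : g (RtoC 0) = RtoC 0).
{ apply Cmod_eq_0. apply Rle_antisym; [|apply Cmod_ge_0].
  (* At [z = 0] and [t = 0] the right-hand side of the ray estimate vanishes. *)
  assert (H := tail_ray a g Hf Hsum (RtoC 0) 0 H0u ltac:(lra)).
  replace (0 * g (RtoC 0) - g (RtoC 0 * RtoC 0))%C with (- g (RtoC 0))%C in H.
  2: { replace (0 * 0)%C with (RtoC 0) by ring. ring. }
  rewrite Cmod_opp, Cmod_0 in H. lra. }
assert (f0 : f (RtoC 0) = RtoC 0) by (rewrite fE, g0; ring).
assert (Hder : forall z, unit_disk z -> exists d : C,
  is_derive (K := C_AbsRing) (V := C_NormedModule) f z (1 + d)%C /\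
  Cmod d <= c * Cmod z /\ Cmod (z * d - g z) <= L * Cmod z ^ 2).
{ intros z Hz. destruct (tail_derive a g Hf Hsum z Hz) as [d [Hd Hb]].
  exists d. split; [|exact Hb].
  apply (is_derive_ext (K := C_AbsRing) (V := C_NormedModule) (fun z => plus z (g z))).
  - intros t. symmetry. apply fE.
  - apply (is_derive_plus (K := C_AbsRing) (V := C_NormedModule)); [|exact Hd].
    (* [is_derive_id] concerns the ring as a module over itself: linearity is supplied for
       [C_NormedModule], and the domination part carries over. *)
    split; [apply (is_linear_scal_l (V := C_NormedModule))|].
    exact (proj2 (is_derive_id (K := C_AbsRing) z)). }
assert (Hinj : univalent f).
(* Equal values give [z1 - z2 = g z2 - g z1], which contradicts the contraction unless both sides
   are 0. *)
{ intros z1 z2 H1 H2 E. rewrite !fE in E.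
  assert (E' : (z1 - z2)%C = (g z2 - g z1)%C).
  { replace (z1 - z2)%C with ((z1 + g z1) - g z1 - z2)%C by ring. rewrite E. ring. }
  assert (H := Hlip z1 z2 H1 H2). rewrite <- E', (Cmod_minus_sym z2 z1) in H.
  assert (E0 : (z1 - z2)%C = RtoC 0).
  { apply Cmod_eq_0. generalize (Cmod_ge_0 (z1 - z2)). nra. }
  replace z1 with ((z1 - z2) + z2)%C by ring. rewrite E0. ring. }
assert (Hsolve : forall (z0 zeta : C) (rho : R), 0 <= rho ->
  (forall w, Cmod (w - z0) <= rho -> unit_disk w) ->
  Cmod (zeta - f z0) <= (1 - c) * rho -> disk_image f zeta).
{ intros z0 zeta rho Hrho Hin Hz.
  destruct (perturbed_id_solvable g c rho z0 zeta) as [w [Hw E]].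
  - lra.
  - exact Hrho.
  - intros w w' Hw Hw'. apply Hlip; now apply Hin.
  - now rewrite <- fE.
  - exists w. split; [now apply Hin|]. now rewrite fE. }
assert (Hstar : starlike_wrt_0 (disk_image f)).
{ intros w t [z [Hz <-]] Ht.
  apply (Hsolve (t * z)%C (t * f z)%C ((1 - t) * Cmod z)).
  - generalize (Cmod_ge_0 z). nra.
  - intros w Hw. unfold unit_disk in *. replace w with ((w - t * z) + t * z)%C by ring.
    eapply Rle_lt_trans; [apply Cmod_triangle|].
    rewrite Cmod_mult, Cmod_R, (Rabs_pos_eq t) by lra. lra.
  - rewrite !fE. replace (t * (z + g z) - (t * z + g (t * z)))%C with (t * g z - g (t * z))%C by ring.
    eapply Rle_trans; [apply (tail_ray a g Hf Hsum z t Hz Ht)|].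
    fold L. apply Rmult_le_compat_r; [|lra].
    generalize (Cmod_ge_0 z). nra. }
split.
- split; [|split; [exact Hinj | split; [|exact Hstar]]].
  + split; [|split; [exact f0|]].
    * intros z Hz. destruct (Hder z Hz) as [d [Hd _]]. now exists (1 + d)%C.
    * destruct (Hder (RtoC 0) H0u) as [d [Hd [Hd0 _]]].
      rewrite (is_C_derive_unique f (RtoC 0) _ Hd).
      (* The bound [c * Cmod z] on the derivative of the tail is 0 at the origin, so [f'(0) = 1]. *)
      rewrite Cmod_0, Rmult_0_r in Hd0.
      replace d with (RtoC 0); [ring|]. symmetry. apply Cmod_eq_0.
      now apply Rle_antisym; [|apply Cmod_ge_0].
  + split; [|split].
    * exists (RtoC 0), (RtoC 0). now split.
    * intros w [z [Hz <-]].
      (* Half the distance to the unit circle keeps the closed disk about [z] inside the unit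
         disk. *)
      assert (Hrho : 0 < (1 - Cmod z) / 2) by (unfold unit_disk in Hz; lra).
      assert (Hdel : 0 < (1 - c) * ((1 - Cmod z) / 2)) by (apply Rmult_lt_0_compat; lra).
      apply (locally_le_locally_norm (V := C_NormedModule)).
      exists (mkposreal _ Hdel). intros zeta Hzeta.
      change (Cmod (zeta - f z) < (1 - c) * ((1 - Cmod z) / 2)) in Hzeta.
      apply (Hsolve z zeta ((1 - Cmod z) / 2)); [lra | | lra].
      intros w Hw. unfold unit_disk in *. replace w with ((w - z) + z)%C by ring.
      eapply Rle_lt_trans; [apply Cmod_triangle|]. lra.
    * apply starlike_connected; [|exact Hstar]. exists (RtoC 0). now split.
- intros z Hz. unfold starlike_quotient.
  destruct (Ceq_dec z (RtoC 0)) as [_ | Hnz]; [simpl; lra|].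
  destruct (Hder z Hz) as [d [Hd [_ Hb]]].
  rewrite (is_C_derive_unique f z _ Hd).
  apply Re_quotient_pos.
  replace (z * (1 + d) - f z)%C with (z * d - g z)%C by (rewrite fE; ring).
  assert (Hz0 := proj1 (Cmod_gt_0 z) Hnz). unfold unit_disk in Hz.
  assert (Hfz : (1 - c) * Cmod z <= Cmod (f z)).
  { assert (H := Hlip (RtoC 0) z H0u Hz). rewrite g0 in H.
    replace (g z - 0)%C with (g z) in H by ring. replace (z - 0)%C with z in H by ring.
    assert (H1 : Cmod z <= Cmod (f z) + Cmod (g z)).
    { replace z with (f z + - g z)%C at 1 by (rewrite fE; ring).
      rewrite <- (Cmod_opp (g z)). apply Cmod_triangle. }
    lra. }
  assert (Hpos : 0 < Cmod (f z)) by nra.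
  (* The chain is [L * |z|^2 <= (1 - c) * |z| * |z| <= |f z| * |z| < |f z|]; strictness comes from
     [|z| < 1]. *)
  apply Rle_lt_trans with (Cmod (f z) * Cmod z); [|nra].
  eapply Rle_trans; [exact Hb|].
  replace (L * Cmod z ^ 2) with (L * Cmod z * Cmod z) by ring.
  apply Rmult_le_compat_r; nra.
Qed.

(** * Bounds on the coefficients of [Qmu] *)

(** Concavity of [ln]: the tangent at [1 + u], evaluated at [1 + alpha u] and at
    [1], with weights [1] and [alpha - 1]. *)
Lemma Rpower_bernoulli (u alpha : R) :
  0 <= u -> 1 <= alpha -> 1 + alpha * u <= Rpower (1 + u) alpha.
Proof.
intros Hu Ha.
assert (Hau : 0 <= alpha * u) by (apply Rmult_le_pos; lra).
rewrite <- (exp_ln (1 + alpha * u)) by lra. unfold Rpower.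
assert (Hln : forall x, 0 < x -> ln x <= x - 1).
{ intros x Hx. generalize (exp_ineq1_le (ln x)). rewrite exp_ln by exact Hx. lra. }
assert (H1 := Hln ((1 + alpha * u) / (1 + u)) ltac:(apply Rdiv_lt_0_compat; lra)).
assert (H2 := Hln (/ (1 + u)) ltac:(apply Rinv_0_lt_compat; lra)).
unfold Rdiv in H1. rewrite ln_mult in H1 by (try apply Rinv_0_lt_compat; lra).
rewrite ln_Rinv in H1, H2 by lra.
assert (H3 : (1 + alpha * u) * / (1 + u) - 1 + (alpha - 1) * (/ (1 + u) - 1) = 0) by (field; lra).
assert (H4 : ln (1 + alpha * u) <= alpha * ln (1 + u)) by nra.
destruct H4 as [H4 | H4]; [left; now apply exp_increasing | right; now rewrite H4].
Qed.

(** With [x = n!] and [m = mu + 1], the coefficient is [x] divided by the power [m] of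
    [1 + (x ^ 2 - 1) / (r ^ 2 + 1)]. Since [r ^ 2 + 1 <= m], this base is at least [1 + y], and
    Bernoulli's inequality applies to [1 + y]. *)
Lemma Q_coef_le (mu r : R) (n : nat) : 2 <= mu -> r ^ 2 <= mu ->
  Q_coef mu r n <= 27 * INR (fact n) / (INR (fact n) ^ 2 + 2) ^ 3.
Proof.
intros Hmu Hr. unfold Q_coef.
assert (Hf : 1 <= INR (fact n)).
{ apply (le_INR 1). generalize (lt_O_fact n). lia. }
set (x := INR (fact n)) in *.
assert (Hr2 : 0 <= r ^ 2) by apply pow2_ge_0.
assert (Hx2 : 1 <= x ^ 2) by nra.
set (m := mu + 1).
set (y := (x ^ 2 - 1) / m).
assert (Hy : 0 <= y) by (apply Rdiv_le_0_compat; unfold m; lra).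
assert (HP : 0 < Rpower (r ^ 2 + 1) m) by apply exp_pos.
assert (Hq : 1 + y <= (x ^ 2 + r ^ 2) / (r ^ 2 + 1)).
{ replace ((x ^ 2 + r ^ 2) / (r ^ 2 + 1)) with (1 + (x ^ 2 - 1) / (r ^ 2 + 1)) by (field; lra).
  apply Rplus_le_compat_l. apply Rmult_le_compat_l; [lra|].
  apply Rinv_le_contravar; unfold m; lra. }
assert (Hbase : ((x ^ 2 + 2) / 3) ^ 3 <= Rpower ((x ^ 2 + r ^ 2) / (r ^ 2 + 1)) m).
{ apply Rle_trans with (Rpower (1 + y) m).
  2: { apply Rle_Rpower_l; unfold m; lra. }
  (* Bernoulli is used with exponent [m / 3], which is at least 1 because [mu >= 2], and the result
     is cubed: [1 + m / 3 * y = (x ^ 2 + 2) / 3]. *)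
  replace m with (m / 3 * INR 3) at 1 by (simpl; field).
  rewrite <- Rpower_mult, Rpower_pow by apply exp_pos.
  apply pow_incr. split; [lra|].
  eapply Rle_trans; [|apply Rpower_bernoulli; [exact Hy | unfold m; lra]].
  right. unfold y. field. unfold m; lra. }
replace (x ^ 2 + r ^ 2) with ((r ^ 2 + 1) * ((x ^ 2 + r ^ 2) / (r ^ 2 + 1))) by (field; lra).
rewrite <- Rpower_mult_distr by (try apply Rdiv_lt_0_compat; lra).
fold m. set (D := Rpower ((x ^ 2 + r ^ 2) / (r ^ 2 + 1)) m) in *.
assert (HD : 0 < D) by apply exp_pos.
assert (HX : 0 < ((x ^ 2 + 2) / 3) ^ 3) by (apply pow_lt; lra).
replace (x * Rpower (r ^ 2 + 1) m / (Rpower (r ^ 2 + 1) m * D)) with (x * / D) by (field; lra).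
replace (27 * x / (x ^ 2 + 2) ^ 3) with (x * / ((x ^ 2 + 2) / 3) ^ 3).
2: { field. lra. }
apply Rmult_le_compat_l; [lra|]. now apply Rinv_le_contravar.
Qed.

Lemma fact_ge_pow3 (k : nat) : (2 * 3 ^ k <= fact (k + 2))%nat.
Proof.
induction k as [|k IH]; [simpl; lia|].
change (fact (S k + 2)) with ((S (k + 2)) * fact (k + 2))%nat.
rewrite Nat.pow_succ_r'. nia.
Qed.

Lemma fact_ge_self (n : nat) : (n <= fact n)%nat.
Proof.
destruct n as [|n]; [lia|].
change (fact (S n)) with (S n * fact n)%nat. generalize (lt_O_fact n). nia.
Qed.

Lemma sq_mul_Q_coef_le (mu r : R) (k : nat) : 2 <= mu -> r ^ 2 <= mu ->
  INR (k + 2) ^ 2 * Q_coef mu r (k + 2) <= (1 / 4) ^ k.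
Proof.
intros Hmu Hr.
eapply Rle_trans.
{ apply Rmult_le_compat_l; [apply pow2_ge_0 | now apply Q_coef_le]. }
(* For [n = 2] the bound is an equality: [4 * 27 * 2 / 6 ^ 3 = 1]. For larger [n], [n <= n!] reduces
   the claim to a bound on [27 / (n!) ^ 3]. *)
destruct k as [|k]; [simpl; lra|].
assert (Hn := le_INR _ _ (fact_ge_self (S k + 2))).
assert (H3 := le_INR _ _ (fact_ge_pow3 (S k))).
rewrite mult_INR, pow_INR in H3.
replace (INR 2) with 2 in H3 by reflexivity.
replace (INR 3) with 3 in H3 by (simpl; ring).
set (x := INR (fact (S k + 2))) in *. set (N := INR (S k + 2)) in *.
assert (HN : 0 <= N) by apply pos_INR.
set (t := 3 ^ k).
assert (Ht : 0 < t) by (apply pow_lt; lra).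
replace (2 * 3 ^ S k) with (6 * t) in H3 by (unfold t; simpl; ring).
(* This is [(27 / 4) ^ k >= 1]. Together with [x >= 6 * t] it gives [27 / x ^ 3 <= (1 / 4) ^ k / 8],
   within the required [(1 / 4) ^ k / 4]. *)
assert (Hq : (1 / 4) ^ k * (27 * t ^ 3) >= 27).
{ unfold t. rewrite <- pow_mult, Nat.mul_comm, pow_mult.
  replace ((1 / 4) ^ k * (27 * (3 ^ 3) ^ k)) with (27 * ((1 / 4) ^ k * (3 ^ 3) ^ k)) by ring.
  rewrite <- Rpow_mult_distr.
  assert (1 <= (1 / 4 * 3 ^ 3) ^ k) by (apply pow_R1_Rle; lra). lra. }
apply Rle_trans with (27 / x ^ 3).
- replace (N ^ 2 * (27 * x / (x ^ 2 + 2) ^ 3)) with (27 * (N ^ 2 * x) / (x ^ 2 + 2) ^ 3).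
  2: { field. nra. }
  assert (Hx : 0 < x) by lra.
  replace (27 / x ^ 3) with (27 * (x ^ 2 * x) / (x ^ 2) ^ 3) by (field; lra).
  apply Rmult_le_compat.
  + apply Rmult_le_pos; [lra|]. apply Rmult_le_pos; [apply pow2_ge_0 | lra].
  + left. apply Rinv_0_lt_compat, pow_lt. nra.
  + apply Rmult_le_compat_l; [lra|]. apply Rmult_le_compat_r; [lra|].
    apply pow_incr; lra.
  + apply Rinv_le_contravar; [apply pow_lt; nra|]. apply pow_incr. nra.
- assert (Hx3 : (6 * t) ^ 3 <= x ^ 3) by (apply pow_incr; lra).
  assert (Ht3 : 0 < t ^ 3) by (apply pow_lt; lra).
  replace ((6 * t) ^ 3) with (216 * t ^ 3) in Hx3 by ring.
  apply Rle_div_l; [lra|]. simpl ((1 / 4) ^ S k).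
  assert (0 < (1 / 4) ^ k) by (apply pow_lt; lra). nra.
Qed.

Theorem theorem3p2 (mu r : R) (hmu : 2 <= mu) (hr0 : 0 < r) (hr : r <= sqrt mu) :
  starlike (Qmu mu r) /\
  (forall z : C, unit_disk z -> 0 < Re (starlike_quotient (Qmu mu r) z)).
Proof.
assert (Hr2 : r ^ 2 <= mu).
{ rewrite <- (pow2_sqrt mu) by lra. apply pow_incr. lra. }
assert (HQ0 : forall k, 0 <= Q_coef mu r (k + 2)) by (intros k; apply Q_coef_bound; lra).
assert (Hgeom : is_series (fun k => (1 / 4) ^ k) (4 / 3)).
{ replace (4 / 3) with (/ (1 - 1 / 4)) by field.
  apply is_series_geom. rewrite Rabs_pos_eq; lra. }
assert (HC : forall k, Cmod (RtoC (Q_coef mu r (k + 2))) = Q_coef mu r (k + 2)).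
{ intros k. rewrite Cmod_R. now apply Rabs_pos_eq. }
assert (Hb := fun k => sq_mul_Q_coef_le mu r k hmu Hr2).
apply starlike_of_coef_bound with (a := fun k => RtoC (Q_coef mu r (k + 2))).
- intros z Hz. apply Qmu_converges; [lra | exact Hz].
- apply (ex_series_le (V := R_CompleteNormedModule)) with (b := fun k => (1 / 4) ^ k); [|now exists (4 / 3)].
  intros k. rewrite HC.
  change (Rabs (INR (k + 2) ^ 2 * Q_coef mu r (k + 2)) <= (1 / 4) ^ k).
  rewrite Rabs_pos_eq; [apply Hb|]. apply Rmult_le_pos; [apply pow2_ge_0 | apply HQ0].
- apply Rle_trans with (Series (fun k => 3 / 4 * (1 / 4) ^ k)).
  + apply Series_le.
    * intros k. rewrite HC.
      generalize (HQ0 k) (Hb k) (pos_INR k). rewrite INR_shift2. intros H0 H1 H2.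
      split; [apply Rmult_le_pos; lra|].
      (* The constant is sharp at [n = 2]: [3 / 4 * n ^ 2 - (2 * n - 1) = (3 * n - 2) * (n - 2) /
         4]. The geometric sum [4 / 3] then gives exactly 1. *)
      apply Rle_trans with (3 / 4 * ((INR k + 2) ^ 2 * Q_coef mu r (k + 2))); [|lra].
      rewrite <- Rmult_assoc. apply Rmult_le_compat_r; [exact H0 | nra].
    * apply (ex_series_scal_l (3 / 4) (fun k => (1 / 4) ^ k)). now exists (4 / 3).
  + rewrite Series_scal_l. erewrite is_series_unique by exact Hgeom. lra.
Qed.
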